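(* Let $M$ be a simple matroid on a finite ground set $E$ with closure operator $\operatorname{cl}$ and set of circuits $\mathcal{C}$. Suppose that for every $C \in \mathcal{C}$ either $\operatorname{cl}(C) = C$, or there exists $f \in \operatorname{cl}(C)$ such that $C \cup \{f\}$ is a double circuit of degree $3$. Then $\{ C \in \mathcal{C} \mid \operatorname{cl}(C) = C\}$ is the unique minimal tropical basis of $M$.
   Context: Let $r$ be the rank function of $M$. A set $D \subseteq E$ is a double circuit if for every $e \in D$, $r(D) = |D|-2 = r(D\setminus\{e\})$. Every double circuit $D$ has a unique partition $D = D_1 \cup \cdots \cup D_k$ such that the circuits of $M$ contained in $D$ are exactly the sets $D \setminus D_i$, $1 \le i \le k$; the number $k$ is the degree of $D$. A subset $\mathcal{C}' \subseteq \mathcal{C}$ is a tropical basis of $M$ if for every $X \subseteq E$ with $X \neq \operatorname{cl}(X)$ there exists $C \in \mathcal{C}'$ with $|C \setminus X| = 1$. A tropical basis $\mathcal{C}'$ is minimal if for every $C \in \mathcal{C}'$ the family $\mathcal{C}' \setminus \{C\}$ is not a tropical basis. *)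

(* Defs.v *)
From HB Require Import structures.
From mathcomp Require Import all_boot.

Set Implicit Arguments.
Unset Strict Implicit.
Unset Printing Implicit Defensive.

(* The ground set is the whole finite type E. *)
Record matroid (E : finType) := Matroid {
  indep : {set {set E}};
  indep0 : set0 \in indep;
  indepS : forall I J : {set E}, I \subset J -> J \in indep -> I \in indep;
  indep_aug : forall I J : {set E},
    I \in indep -> J \in indep -> #|I| < #|J| ->
    exists2 e, e \in J :\: I & e |: I \in indep
}.

Definition rank (E : finType) (M : matroid E) (X : {set E}) : nat :=
  \max_(I in indep M | I \subset X) #|I|.

Definition cl (E : finType) (M : matroid E) (X : {set E}) : {set E} :=
  [set e | rank M (e |: X) == rank M X].

Definition circuits (E : finType) (M : matroid E) : {set {set E}} :=
  [set C : {set E} | minset [pred X : {set E} | X \notin indep M] C].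

(* Neither loops (circuits of size 1) nor parallel pairs (circuits of size 2);
   the empty set is independent, so it is never a circuit. *)
Definition simple_matroid (E : finType) (M : matroid E) : Prop :=
  forall C, C \in circuits M -> 2 < #|C|.

(* The equation r = |D| - 2 is written r + 2 = |D| because subtraction on nat
   is truncated. *)
Definition double_circuit (E : finType) (M : matroid E) (D : {set E}) : Prop :=
  forall e, e \in D ->
    rank M D + 2 = #|D| /\ rank M (D :\ e) + 2 = #|D|.

Definition principal_partition (E : finType) (M : matroid E) (D : {set E})
    (P : {set {set E}}) : Prop :=
  partition P D /\
  [set C in circuits M | C \subset D] = [set D :\: A | A in P].

Lemma principal_partition_uniq (E : finType) (M : matroid E) (D : {set E})
    (P Q : {set {set E}}) :
  principal_partition M D P -> principal_partition M D Q -> P = Q.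
Proof.
suff recover (R : {set {set E}}) : principal_partition M D R ->
    R = [set D :\: C | C in [set C in circuits M | C \subset D]].
  by move=> /recover -> /recover ->.
case=> /and3P[/eqP covR _ _] ->; rewrite -imset_comp -[LHS]imset_id.
apply: eq_in_imset => A RA /=; rewrite setDDr setDv set0U.
by apply/esym/setIidPr; rewrite -covR; apply: bigcup_sup.
Qed.

(* The parts of a partition are nonempty and disjoint, hence distinct, so the
   number of parts is #|P|; the value of k is determined by D in view of
   principal_partition_uniq. *)
Definition double_circuit_of_degree (E : finType) (M : matroid E) (k : nat)
    (D : {set E}) : Prop :=
  double_circuit M D /\ exists2 P, principal_partition M D P & #|P| = k.

Definition tropical_basis (E : finType) (M : matroid E)
    (B : {set {set E}}) : Prop :=
  B \subset circuits M /\
  forall X : {set E}, X <> cl M X -> exists2 C, C \in B & #|C :\: X| = 1.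

Definition minimal_tropical_basis (E : finType) (M : matroid E)
    (B : {set {set E}}) : Prop :=
  tropical_basis M B /\ forall C, C \in B -> ~ tropical_basis M (B :\ C).

(* Main.v *)
Require Import Defs.
From HB Require Import structures.
From mathcomp Require Import all_boot.

(** A closed circuit [C] is forced into every tropical basis: for [e] in [C],
    the set [C :\ e] is not closed, and any circuit meeting its complement in
    one point lies in [cl C = C].  Conversely, if [X] is not closed, take a
    smallest circuit [C] with [C :\: X] a single point [e].  If [C] were not
    closed, the degree 3 double circuit [f |: C] would split [C] into [A] and
    [B] with [f |: A] and [f |: B] circuits; both are shorter than [C] because
    [M] is simple, and one of them meets the complement of [X] in one point
    (the part containing [e] if [f] is in [X], the other part if not). *)

Set Implicit Arguments.
Unset Strict Implicit.
Unset Printing Implicit Defensive.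

Section Matroid.

Variables (E : finType) (M : matroid E).
Implicit Types (C I X Y : {set E}) (B : {set {set E}}).

Lemma leq_rank I X : I \in indep M -> I \subset X -> #|I| <= rank M X.
Proof.
by move=> indI sIX; rewrite /rank (bigmax_sup I) ?indI.
Qed.

Lemma rank_leP X n :
  reflect (forall I, I \in indep M -> I \subset X -> #|I| <= n)
          (rank M X <= n).
Proof.
rewrite /rank; apply: (iffP (bigmax_leqP _ _ _)) => [le_n I indI sIX | le_n I /andP[]].
  by apply: le_n; rewrite indI.
exact: le_n.
Qed.

Lemma rankS X Y : X \subset Y -> rank M X <= rank M Y.
Proof.
by move=> sXY; apply/rank_leP => I indI sIX;
  apply: leq_rank (subset_trans sIX sXY).
Qed.

Lemma rank_basis X : exists2 I, I \in indep M & I \subset X /\ #|I| = rank M X.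
Proof.
pose P := [pred I | (I \in indep M) && (I \subset X)].
(* The empty set makes the family nonempty, so the maximum is attained and is not the default value
   0. *)
have P0 : P set0 by rewrite /= indep0 sub0set.
rewrite /rank (bigmax_eq_arg set0 (P := P)) //.
by case: arg_maxnP => // I /andP[indI sIX] _; exists I.
Qed.

Lemma sub_cl X : X \subset cl M X.
Proof. by apply/subsetP => e Xe; rewrite inE (setUidPr _) ?sub1set. Qed.

Lemma circuit_dep C : C \in circuits M -> C \notin indep M.
Proof. by rewrite inE => /minsetp. Qed.

Lemma circuit_inj C C' :
  C \in circuits M -> C' \in circuits M -> C' \subset C -> C' = C.
Proof.
by rewrite inE => minC circC'; apply: minsetinf minC (circuit_dep circC').
Qed.

Lemma circuitD1_indep C e : C \in circuits M -> e \in C -> C :\ e \in indep M.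
Proof.
rewrite inE => minC Ce; apply: contraT => depCe.
by have := in_setD1 e C e; rewrite (minsetinf minC depCe (subD1set C e)) Ce eqxx.
Qed.

Lemma rank_circuit C e : C \in circuits M -> e \in C -> rank M C = #|C :\ e|.
Proof.
move=> circC Ce; apply/eqP; rewrite eqn_leq.
rewrite (leq_rank (circuitD1_indep circC Ce) (subD1set C e)) andbT.
apply/rank_leP => I indI sIC.
suff /proper_card : I \proper C by rewrite (cardsD1 e C) Ce.
by rewrite properEneq sIC andbT; apply: contraTneq indI => ->; apply: circuit_dep.
Qed.

(** A point [e] of the closure outside [X] makes [e |: I] dependent for a largest independent [I]
    inside [X]. A circuit inside [e |: I] must use [e], as [I] is independent, and all its other
    points lie in [X]. *)
Lemma nonclosed_circuit X :
  X <> cl M X -> exists2 C, C \in circuits M & #|C :\: X| = 1.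
Proof.
move=> neX; have /subsetPn[e] : ~~ (cl M X \subset X).
  by apply/negP => sclX; apply: neX; apply/eqP; rewrite eqEsubset sub_cl.
rewrite inE => /eqP rke nXe.
have [I indI [sIX cardI]] := rank_basis X.
have nIe : e \notin I by apply: contra nXe; apply: subsetP.
have depeI : e |: I \notin indep M.
  apply/negP => /leq_rank/(_ (setUS [set e] sIX)).
  by rewrite cardsU1 nIe rke cardI ltnn.
have [C minC sCeI] := minset_exists (P := [pred Y | Y \notin indep M]) depeI.
have circC : C \in circuits M by rewrite inE.
exists C => //; apply/eqP/cards1P; exists e; apply/eqP.
rewrite eqEsubset sub1set inE nXe /=; apply/andP; split.
  rewrite subDset setUC; exact: subset_trans sCeI (setUS _ sIX).
apply: contraNT (circuit_dep circC) => nCe; apply: indepS indI.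
apply/subsetP => x Cx; have /setU1P[xe|//] := subsetP sCeI x Cx.
by rewrite -xe Cx in nCe.
Qed.

Lemma circuit_closed_forced C C' e :
  C \in circuits M -> cl M C = C -> e \in C ->
  C' \in circuits M -> #|C' :\: (C :\ e)| = 1 -> C' = C.
Proof.
move=> circC clC Ce circC' /eqP/cards1P[g C'g]; apply: circuit_inj => //.
have sC'g : C' \subset g |: (C :\ e) by rewrite setUC -subDset C'g.
suff Cg : g \in C.
  by apply: subset_trans sC'g _; rewrite subUset sub1set Cg subD1set.
rewrite -clC inE eqn_leq (rankS (subsetUr _ _)) andbT (rank_circuit circC Ce).
apply/rank_leP => J indJ sJ; rewrite leqNgt; apply/negP => ltJ.
(* An independent [J] larger than [C :\ e] would extend [C :\ e] either by [g], making [C']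
   independent, or by [e], making [C] independent. *)
have [j] := indep_aug (circuitD1_indep circC Ce) indJ ltJ.
rewrite !inE negb_and negbK => /andP[nj Jj] indj.
have /setU1P[jg | Cj] := subsetP sJ j Jj.
  by move/negP: (circuit_dep circC'); apply; apply: indepS indj; rewrite jg.
move: nj indj; rewrite Cj orbF => /eqP->; rewrite setD1K //.
exact/negP/circuit_dep.
Qed.

Lemma closed_circuit_mem_tropical B C :
  tropical_basis M B -> C \in circuits M -> cl M C = C -> C \in B.
Proof.
move=> [sB tropB] circC clC.
have /set0Pn[e Ce] : C != set0.
  by apply: contraNneq (circuit_dep circC) => ->; apply: indep0.
have [|C' BC' C'1] := tropB (C :\ e).
  (* The point [e] lies in the closure of [C :\ e], because [C] and the independent set [C :\ e]
     both have rank [#|C :\ e|]. *)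
  move=> clCe; have := in_setD1 e C e; rewrite eqxx /= {1}clCe inE setD1K //.
  rewrite (rank_circuit circC Ce) eqn_leq leq_rank ?circuitD1_indep //=.
  by move/rank_leP; case=> I _; apply: subset_leq_card.
by rewrite -(circuit_closed_forced circC clC Ce (subsetP sB _ BC') C'1).
Qed.

(** The circuit [C] is itself the complement in [f |: C] of some part; that part lies in [[set f]]
    and is nonempty, so it equals [[set f]]. The two other parts are [A] and [B], and the complement
    of either one is [f] together with the other. *)
Lemma degree3_split C f :
  C \in circuits M -> double_circuit_of_degree M 3 (f |: C) ->
  exists A B : {set E}, [/\ C = A :|: B, [disjoint A & B], f \notin C,
    f |: A \in circuits M & f |: B \in circuits M].
Proof.
move=> circC [_ [P [partP circP] card3]].
have [/eqP covP trivP nP0] := and3P partP.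
have circD A : A \in P -> (f |: C) :\: A \in circuits M.
  move=> PA; suff: (f |: C) :\: A \in [set C' in circuits M | C' \subset f |: C].
    by rewrite inE => /andP[].
  by rewrite circP; apply: imset_f.
have : C \in [set (f |: C) :\: A | A in P] by rewrite -circP inE circC subsetUr.
case/imsetP => F PF defC.
have sFf : F \subset [set f].
  have sFD : F \subset f |: C by rewrite -covP; apply: bigcup_sup.
  apply/subsetP => x Fx; have := subsetP sFD x Fx.
  by rewrite {1}defC !inE Fx /= orbF.
have /eqP defF : F == [set f].
  by move: sFf; rewrite subset1 => /orP[// | /eqP F0]; rewrite -F0 PF in nP0.
rewrite {F sFf}defF in PF defC.
have nCf : f \notin C by rewrite defC !inE eqxx.
have /eqP/cards2P[A [B [neAB defP]]] : #|P :\ [set f]| = 2.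
  by move: card3; rewrite (cardsD1 [set f]) PF => -[].
have /setD1P[neA PA] : A \in P :\ [set f] by rewrite defP !inE eqxx.
have /setD1P[neB PB] : B \in P :\ [set f] by rewrite defP !inE eqxx orbT.
have disP := trivIsetP trivP.
have disAB := disP A B PA PB neAB.
have nAf : f \notin A by rewrite -disjoints1 disjoint_sym disP.
have nBf : f \notin B by rewrite -disjoints1 disjoint_sym disP.
have covAB : f |: C = f |: (A :|: B).
  by rewrite -covP /cover (big_setD1 _ PF) /= defP big_setU1 ?inE // big_set1.
have defAB : C = A :|: B.
  by rewrite -(setU1K nCf) covAB setU1K // inE negb_or nAf.
exists A, B; split=> //.
  suff -> : f |: A = (f |: C) :\: B by apply: circD.
  rewrite covAB; apply/setP => x.
  rewrite !inE; case: eqP => [-> | _] /=; first by rewrite nBf.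
  by case Ax: (x \in A); [rewrite (disjointFr disAB Ax) | rewrite andNb].
suff -> : f |: B = (f |: C) :\: A by apply: circD.
rewrite covAB; apply/setP => x.
rewrite !inE; case: eqP => [-> | _] /=; first by rewrite nAf.
by case Bx: (x \in B); [rewrite (disjointFl disAB Bx) | rewrite orbF andNb].
Qed.

Lemma shorter_circuit C f X :
  simple_matroid M -> C \in circuits M ->
  double_circuit_of_degree M 3 (f |: C) -> #|C :\: X| = 1 ->
  exists2 C', C' \in circuits M & #|C' :\: X| = 1 /\ #|C'| < #|C|.
Proof.
move=> simpleM circC /(degree3_split circC)[A [B [defC disAB nCf circA circB]]].
move=> /eqP/cards1P[e CXe].
wlog Ae : A B defC disAB circA circB / e \in A.
  move=> IH; have : e \in C :\: X by rewrite CXe inE.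
  rewrite inE {1}defC inE => /andP[_ /orP[Ae | Be]]; first exact: (IH A B).
  by apply: (IH B A) => //; [rewrite setUC | rewrite disjoint_sym].
have cardC : #|C| = #|A| + #|B| by rewrite defC cardsU disjoint_setI0 ?cards0 ?subn0.
move: (nCf); rewrite {1}defC inE negb_or => /andP[nAf nBf].
(* Simplicity gives [A] and [B] at least two points each, so replacing either of them by the single
   point [f] shortens [C]. *)
have := simpleM _ circA; have := simpleM _ circB.
rewrite !cardsU1 nAf nBf !ltnS => gtB gtA.
have outX x : x \in C -> (x \notin X) = (x == e).
  by move=> Cx; rewrite -in_set1 -CXe inE Cx andbT.
have sAC : A \subset C by rewrite defC subsetUl.
have sBC : B \subset C by rewrite defC subsetUr.
case Xf: (f \in X).
  exists (f |: A) => //; split; last by rewrite cardsU1 nAf cardC addnC ltn_add2l.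
  apply/eqP/cards1P; exists e; apply/setP => x; rewrite !inE.
  case: (altP (x =P f)) => [-> | _] /=.
    by rewrite Xf; apply/esym; apply: contraNF nAf => /eqP->.
  case Ax: (x \in A); first by rewrite andbT outX // (subsetP sAC).
  by rewrite andbF; apply/esym; apply: contraFF Ax => /eqP->.
(* Now [f] itself is the single point outside [X]: the point [e] lies in [A], so [B] is contained in
   [X]. *)
exists (f |: B) => //; split; last by rewrite cardsU1 nBf cardC ltn_add2r.
apply/eqP/cards1P; exists f; apply/setP => x; rewrite !inE.
case: (altP (x =P f)) => [-> | _] /=; first by rewrite Xf.
case Bx: (x \in B); last by rewrite andbF.
rewrite andbT outX ?(subsetP sBC) //; apply: contraTF Bx => /eqP->.
by rewrite (disjointFr disAB Ae).
Qed.

End Matroid.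

Theorem theorem2 (E : finType) (M : matroid E)
    (simpleM : simple_matroid M)
    (hM : forall C : {set E}, C \in circuits M ->
       cl M C = C \/
       exists2 f, f \in cl M C & double_circuit_of_degree M 3 (f |: C)) :
  minimal_tropical_basis M [set C in circuits M | cl M C == C] /\
  (forall B : {set {set E}}, minimal_tropical_basis M B ->
     B = [set C in circuits M | cl M C == C]).
Proof.
set B0 := [set C in circuits M | cl M C == C].
have tropB0 : tropical_basis M B0.
  split=> [|X /nonclosed_circuit[C]].
    by apply/subsetP => C; rewrite inE => /andP[].
  (* Strong induction on [#|C|] replaces the choice of a smallest circuit. *)
  have [n] := ubnP #|C|; elim: n C => // n IH C leCn circC CX1.
  have [clC | [f _ degf]] := hM C circC.
    by exists C => //; rewrite inE circC clC eqxx.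
  have [C' circC' [C'X1 ltC']] := shorter_circuit simpleM circC degf CX1.
  by apply: (IH C') => //; apply: leq_trans ltC' leCn.
have sub_trop B : tropical_basis M B -> B0 \subset B.
  move=> tropB; apply/subsetP => C; rewrite inE => /andP[circC /eqP clC].
  exact: closed_circuit_mem_tropical tropB circC clC.
(* [B0] lies in every tropical basis, so no proper subfamily of [B0] is one. *)
split=> [|B [tropB minB]].
  split=> // C B0C /sub_trop/subsetP/(_ C B0C).
  by rewrite !inE eqxx.
apply/eqP; rewrite eqEsubset sub_trop // andbT; apply/subsetP => C BC.
(* If [C] were outside [B0], then [B :\ C] would still contain the tropical basis [B0], against the
   minimality of [B]. *)
apply: contraPT (minB C BC) => nB0C; apply; split.
  exact: subset_trans (subD1set B C) tropB.1.
move=> X /tropB0.2[C' B0C' C'X1]; exists C' => //.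
rewrite in_setD1 (subsetP (sub_trop B tropB)) // andbT.
by apply: contraNneq nB0C => <-.
Qed.
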